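(* Let $W\subset\mathbb{R}^n$ be a simply-connected open set with coordinates $x^1,\dots,x^n$, and let $S=(S_{ij})$ be a smooth $n\times n$ matrix of real-valued functions on $W$, nondegenerate at every point of $W$, such that for every $i$ the entries $S_{i1},\dots,S_{in}$ of the $i$-th row are functions of $x^i$ only. Let $\hat H_1,\dots,\hat H_n$ be the second order differential operators associated with $S$ (defined in the context). (1) Let $V_1(x^1),\dots,V_n(x^n)$ be smooth real-valued functions on $W$, where $V_i$ depends on $x^i$ only, and let $U_1,\dots,U_n:W\to\mathbb{R}$ be the functions determined by $$S\,(U_1,\dots,U_n)^\top=(V_1(x^1),\dots,V_n(x^n))^\top .$$ Then the differential operators $\check H_i=\hat H_i+U_i$, $i=1,\dots,n$, commute pairwise. (2) Conversely, if $U_1,\dots,U_n:W\to\mathbb{R}$ are smooth functions such that the operators $\check H_i=\hat H_i+U_i$, $i=1,\dots,n$, commute pairwise, then there exist functions $V_1,\dots,V_n$, with $V_i$ depending on $x^i$ only, such that $$S\,(U_1,\dots,U_n)^\top=(V_1(x^1),\dots,V_n(x^n))^\top .$$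
   Context: Let $p_1,\dots,p_n$ be the momenta corresponding to $x^1,\dots,x^n$ on $T^*W$. The Stäckel construction associates to $S$ the functions $H_1,\dots,H_n:T^*W\to\mathbb{R}$ determined by the linear system $$S\,(H_1,\dots,H_n)^\top=(p_1^2,\dots,p_n^2)^\top .$$ They are quadratic in the momenta, and $H_{(\alpha)}^{ij}$ denotes the symmetric tensor with $H_\alpha=\sum_{i,j}H_{(\alpha)}^{ij}p_ip_j$. In the coordinates $x^i$ it is diagonal, with $H_{(\alpha)}^{ii}=(S^{-1})_{\alpha i}$ and $H_{(\alpha)}^{ij}=0$ for $i\neq j$. With $\phi:=\det(S)$, the operators $\hat H_\alpha$ act on smooth functions $f$ on $W$ by $$\hat H_\alpha f=\sum_{i,j=1}^n\frac1\phi\frac{\partial}{\partial x^i}\left(H_{(\alpha)}^{ij}\,\phi\,\frac{\partial f}{\partial x^j}\right),\qquad \alpha=1,\dots,n.$$ In $\hat H_i+U_i$ the function $U_i$ acts by multiplication. Convention: a function on $W$ is said to depend on $x^i$ only (to be a function of $x^i$ only) if its partial derivatives with respect to $x^j$ vanish on $W$ for all $j\neq i$. *)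

(* Defs.v *)
From mathcomp Require Export all_boot all_order all_algebra.
From mathcomp Require Export all_classical all_reals all_analysis.
Export Order.TTheory GRing.Theory Num.Theory numFieldNormedType.Exports.

Set Implicit Arguments.
Unset Strict Implicit.
Unset Printing Implicit Defensive.

Global Open Scope classical_set_scope.
Global Open Scope ring_scope.

(* Functions on W are represented by total functions on 'rV[R]_n; all the
   conditions below only involve their values on W when W is open. *)

Definition coord_vec {R : realType} {n : nat} (i : 'I_n) : 'rV[R]_n :=
  delta_mx 0 i.

Definition pderiv {R : realType} {n : nat} (i : 'I_n) (f : 'rV[R]_n -> R) :
  'rV[R]_n -> R := fun x => 'D_(coord_vec i) f x.

(* C^k on W; existence of the partial derivatives has to be required, since
   'D_v f x is a junk value when f is not derivable at x along v. *)
Fixpoint class_C {R : realType} {n : nat} (W : set 'rV[R]_n) (k : nat)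
    (f : 'rV[R]_n -> R) : Prop :=
  match k with
  | 0%N => forall x, W x -> {for x, continuous f}
  | k'.+1 => (forall x, W x -> {for x, continuous f}) /\
      forall i : 'I_n, (forall x, W x -> derivable f x (coord_vec i)) /\
                       class_C W k' (pderiv i f)
  end.

Definition smooth_on {R : realType} {n : nat} (W : set 'rV[R]_n)
  (f : 'rV[R]_n -> R) : Prop := forall k : nat, class_C W k f.

Definition depends_only_on {R : realType} {n : nat} (W : set 'rV[R]_n)
    (i : 'I_n) (f : 'rV[R]_n -> R) : Prop :=
  forall (x : 'rV[R]_n) (j : 'I_n), W x -> j != i ->
    is_derive x (coord_vec j) f 0.

(* A path in W, parametrized by [0, 1]; its values outside [0, 1] are
   irrelevant. *)
Definition path_in {R : realType} {n : nat} (W : set 'rV[R]_n)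
    (g : R -> 'rV[R]_n) : Prop :=
  {within `[0, 1]%classic, continuous g} /\
  (forall t, 0 <= t <= 1 -> W (g t)).

Definition path_connected {R : realType} {n : nat} (W : set 'rV[R]_n) : Prop :=
  W !=set0 /\
  forall x y, W x -> W y ->
    exists g : R -> 'rV[R]_n, [/\ path_in W g, g 0 = x & g 1 = y].

(* The homotopy H (s, t) contracts the loop g = H (0, -) to its base point,
   keeping the base point fixed. *)
Definition null_homotopic {R : realType} {n : nat} (W : set 'rV[R]_n)
    (g : R -> 'rV[R]_n) : Prop :=
  exists H : R * R -> 'rV[R]_n,
    [/\ {within `[0, 1]%classic `*` `[0, 1]%classic, continuous H},
        forall s t, 0 <= s <= 1 -> 0 <= t <= 1 -> W (H (s, t)),
        forall t, 0 <= t <= 1 -> H (0, t) = g t /\ H (1, t) = g 0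
      & forall s, 0 <= s <= 1 -> H (s, 0) = g 0 /\ H (s, 1) = g 0].

Definition simply_connected {R : realType} {n : nat} (W : set 'rV[R]_n) :
    Prop :=
  path_connected W /\
  forall g : R -> 'rV[R]_n, path_in W g -> g 0 = g 1 -> null_homotopic W g.

(* H_alpha (x, p), the solution of S (H_1, ..., H_n)^T = (p_1^2, ..., p_n^2)^T;
   see stackel_hamP. *)
Definition stackel_ham {R : realType} {n : nat} (S : 'rV[R]_n -> 'M[R]_n)
    (a : 'I_n) (x p : 'rV[R]_n) : R :=
  (invmx (S x) *m \col_i (p 0 i ^+ 2)) a 0.

(* The components H_(alpha)^{ij} of the symmetric tensor of H_alpha; see
   stackel_hamE. *)
Definition stackel_tensor {R : realType} {n : nat} (S : 'rV[R]_n -> 'M[R]_n)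
    (a i j : 'I_n) (x : 'rV[R]_n) : R :=
  if i == j then invmx (S x) a i else 0.

Lemma stackel_hamP {R : realType} {n : nat} (S : 'rV[R]_n -> 'M[R]_n)
    (x p : 'rV[R]_n) (h : 'I_n -> R) :
  S x \in unitmx ->
  S x *m \col_a h a = \col_i (p 0 i ^+ 2) <->
  forall a, h a = stackel_ham S a x p.
Proof.
move=> uS; split=> [e a|e].
  by rewrite /stackel_ham -e mulKmx // mxE.
suff -> : \col_a h a = invmx (S x) *m \col_i (p 0 i ^+ 2) by rewrite mulKVmx.
by apply/matrixP=> a j; rewrite (ord1 j) mxE e.
Qed.

Lemma stackel_hamE {R : realType} {n : nat} (S : 'rV[R]_n -> 'M[R]_n)
    (a : 'I_n) (x p : 'rV[R]_n) :
  stackel_ham S a x p =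
  \sum_(i < n) \sum_(j < n) stackel_tensor S a i j x * p 0 i * p 0 j.
Proof.
rewrite /stackel_ham mxE; apply: eq_bigr => i _.
rewrite (bigD1 i) //= big1 => [|j ji]; rewrite /stackel_tensor.
  by rewrite eqxx mxE addr0 expr2 mulrA.
by rewrite eq_sym (negbTE ji) !mul0r.
Qed.

Definition Hhat {R : realType} {n : nat} (S : 'rV[R]_n -> 'M[R]_n) (a : 'I_n)
    (f : 'rV[R]_n -> R) : 'rV[R]_n -> R := fun x =>
  \sum_(i < n) \sum_(j < n)
    (\det (S x))^-1 *
    pderiv i (fun y => stackel_tensor S a i j y * \det (S y) * pderiv j f y) x.

Definition Hcheck {R : realType} {n : nat} (S : 'rV[R]_n -> 'M[R]_n)
    (U : 'I_n -> 'rV[R]_n -> R) (a : 'I_n) (f : 'rV[R]_n -> R) :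
    'rV[R]_n -> R :=
  fun x => Hhat S a f x + U a x * f x.

Definition commute_on {R : realType} {n : nat} (W : set 'rV[R]_n)
    (A B : ('rV[R]_n -> R) -> 'rV[R]_n -> R) : Prop :=
  forall f : 'rV[R]_n -> R, smooth_on W f ->
  forall x, W x -> A (B f) x = B (A f) x.

(* Main.v *)
Require Import Defs.
From mathcomp Require Import ring lra.

Set Implicit Arguments.
Unset Strict Implicit.
Unset Printing Implicit Defensive.

(** Write A = S^-1, d_i for the i-th partial derivative, and V = S U.

    The cofactor of the entry (i, a) of S does not involve row i of S, so d_i
    kills it. Since A_(a i) det S is that cofactor, the divergence form of the
    Stackel operators collapses on W ([HhatE]) to
      Hhat_a f = sum_i A_(a i) d_i^2 f,
    a combination of second derivatives without first order terms.

    Multiplying by S undoes this combination: the one-dimensional Schrodinger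
    operators T_i = d_i^2 + V_i satisfy T_i = sum_a S_(i a) Hcheck_a
    ([stackel_separation]). For i <> j the coefficient S_(j b) does not depend
    on x^i, so it passes through T_i, whence
      [T_i, T_j] f = (S C S^T)_(i j),   C_(a b) = [Hcheck_a, Hcheck_b] f
    ([schrodinger_Hcomm]). The diagonal of S C S^T vanishes because C is
    antisymmetric, and S is invertible, so the operators Hcheck_a commute
    exactly when the operators T_i do.

    By the product rule and the symmetry of second derivatives
    ([schrodinger_comm]),
      [T_i, T_j] f = (d_i^2 V_j) f + 2 (d_i V_j) (d_i f)
                   - (d_j^2 V_i) f - 2 (d_j V_i) (d_j f).
    This is zero when every V_i depends on x^i only. Conversely, if it is zero
    for f = 1 and for f = x^i, then d_i V_j = 0.

    All these computations are local on the open set W. The rest of the work is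
    the calculus they rely on: smooth functions form an algebra stable under
    differentiation and inversion, and mixed partial derivatives commute
    ([derive_comm]). *)

(** * Symmetry of second derivatives *)

Section Schwarz.
Context {R : realType} {E : normedModType R}.
Implicit Types (f : E -> R) (u v a x y : E).

Lemma is_derive_translate f a x v df :
  is_derive (a + x) v f df -> is_derive x v (fun z => f (a + z)) df.
Proof.
move=> [fD <-].
have growthE : (fun h : R =>
    h^-1 *: (((fun z => f (a + z)) \o shift x) (h *: v) - f (a + x)))
   = (fun h => h^-1 *: ((f \o shift (a + x)) (h *: v) - f (a + x))).
  by apply/funext => h /=; rewrite (addrCA a).
by apply: DeriveDef; rewrite /derivable /derive growthE.
Qed.

Lemma is_derive_line f y v (t : R) df :
  is_derive (t *: v + y) v f df -> is_derive t 1 (fun s => f (s *: v + y)) df.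
Proof.
move=> [fD <-].
have growthE : (fun h : R =>
    h^-1 *: (((fun s => f (s *: v + y)) \o shift t) (h *: 1)
      - f (t *: v + y)))
   = (fun h => h^-1 *: ((f \o shift (t *: v + y)) (h *: v) - f (t *: v + y))).
  by apply/funext => h /=; rewrite [_%:A]mulr1 scalerDl addrA.
by apply: DeriveDef; rewrite /derivable /derive growthE.
Qed.

Lemma MVT_line f y v (h : R) : 0 < h ->
  (forall t, 0 <= t <= h -> derivable f (t *: v + y) v) ->
  exists2 t, 0 <= t <= h & f (h *: v + y) - f y = 'D_v f (t *: v + y) * h.
Proof.
move=> h0 df; pose g s := f (s *: v + y).
have dg t : 0 <= t <= h -> is_derive t 1 g ('D_v f (t *: v + y)).
  by move=> /df /derivableP; apply: is_derive_line.
have [t||t] := @MVT R g (fun t => 'D_v f (t *: v + y)) 0 h h0.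
- by rewrite in_itv /= => /andP[t0 th]; apply: dg; rewrite !ltW.
- by apply: derivable_within_continuous => t /[!in_itv]/= /dg [].
rewrite in_itv /= => /andP[t0 th]; rewrite /g scale0r add0r subr0 => e.
by exists t => //; rewrite !ltW.
Qed.

(** Two applications of the mean value theorem, first along u to
    z |-> f (h v + z) - f z, then along v to 'D_u f. The left-hand side is
    symmetric in u and v, while the right-hand side differentiates in a fixed
    order: this is what forces the two orders to agree. The predicate P carries
    whatever is known near x over to the intermediate point. *)
Lemma second_difference f x u v (h : R) (P : E -> Prop) : 0 < h ->
  (forall s t, 0 <= s <= h -> 0 <= t <= h -> P (s *: u + t *: v + x)) ->
  (forall y, P y -> derivable f y u /\ derivable ('D_u f) y v) ->
  exists2 y, P y &
    f (h *: u + h *: v + x) - f (h *: u + x) - f (h *: v + x) + f x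
    = 'D_v ('D_u f) y * h * h.
Proof.
move=> h0 inP df.
have h1 : 0 <= h <= h by rewrite ltW //=.
have h2 : 0 <= (0 : R) <= h by rewrite lexx ltW.
pose g z := f (h *: v + z) - f z.
have dg s : 0 <= s <= h ->
    is_derive (s *: u + x) u g
      ('D_u f (h *: v + (s *: u + x)) - 'D_u f (s *: u + x)).
  move=> sh.
  have [d1 _] := df _ (inP s h sh h1).
  have [d0 _] := df _ (inP s 0 sh h2).
  apply: is_deriveB; last by apply: derivableP; move: d0; rewrite scale0r addr0.
  apply: is_derive_translate; apply: derivableP.
  by rewrite addrCA addrA; exact: d1.
have [s sh|s sh es] := @MVT_line g x u h h0.
  by case: (dg s sh).
have [t th|t th et] := @MVT_line ('D_u f) (s *: u + x) v h h0.
  by have [_] := df _ (inP s t sh th); rewrite addrCA addrA.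
exists (s *: u + t *: v + x); first exact: inP.
have -> : s *: u + t *: v + x = t *: v + (s *: u + x).
  by rewrite [RHS]addrCA addrA.
rewrite -et.
have [_ <-] := dg s sh; rewrite -es /g.
by rewrite (addrC (h *: u)) -!addrA opprD opprK !addrA.
Qed.

(** The second difference on a small parallelogram equals h^2 times a value of
    'D_v ('D_u f) and also h^2 times a value of 'D_u ('D_v f), both taken near
    x; by continuity, the values at x are then arbitrarily close. *)
Lemma derive_comm f x u v :
  (\forall y \near x, derivable f y u /\ derivable ('D_u f) y v) ->
  (\forall y \near x, derivable f y v /\ derivable ('D_v f) y u) ->
  {for x, continuous ('D_v ('D_u f))} -> {for x, continuous ('D_u ('D_v f))} ->
  'D_v ('D_u f) x = 'D_u ('D_v f) x.
Proof.
move=> duv dvu cuv cvu; apply/eqP; rewrite -subr_eq0 -normr_le0.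
apply/ler_addgt0Pl => e e0; rewrite addr0.
have tri (a b c : R) : `|a - c| < e / 2 -> `|b - c| < e / 2 -> `|a - b| <= e.
  move=> ac bc; rewrite (le_trans (ler_distD c _ _)) // [leRHS]splitr.
  by rewrite (distrC c); apply: lerD; apply: ltW.
have e2 : 0 < e / 2 by rewrite divr_gt0.
pose P y := [/\ derivable f y u /\ derivable ('D_u f) y v,
  derivable f y v /\ derivable ('D_v f) y u,
  `|'D_v ('D_u f) x - 'D_v ('D_u f) y| < e / 2 &
  `|'D_u ('D_v f) x - 'D_u ('D_v f) y| < e / 2].
have : \forall y \near x, P y.
  have /cvgrPdist_lt/(_ _ e2) n1 := cuv.
  have /cvgrPdist_lt/(_ _ e2) n2 := cvu.
  have nF : Filter (nbhs x) := nbhs_filter x.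
  have := @filterI _ _ nF _ _ (@filterI _ _ nF _ _ duv dvu)
    (@filterI _ _ nF _ _ n1 n2).
  apply: (@filterS _ _ nF) => y [[h1 h2] [h3 h4]].
  exact: (And4 h1 h2 h3 h4).
move=> /nbhs_ballP[d /= d0 dP].
(* The side h keeps the parallelogram in the ball of radius d; the summand 1
   avoids dividing by zero when u = v = 0. *)
pose h := d / 2 / (1 + `|u| + `|v|).
have N0 : 0 < 1 + `|u| + `|v| by rewrite -addrA ltr_wpDr // addr_ge0.
have h0 : 0 < h by rewrite !divr_gt0.
have inP s t : 0 <= s <= h -> 0 <= t <= h -> P (s *: u + t *: v + x).
  move=> /andP[s0 sh] /andP[t0 th]; apply: dP.
  rewrite -ball_normE /ball_ /= opprD addrCA subrr addr0 normrN.
  apply: (@le_lt_trans _ _ (h * (1 + `|u| + `|v|))).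
    rewrite (le_trans (ler_normD _ _)) // !normrZ !ger0_norm //.
    rewrite -addrA !mulrDr mulr1 ler_wpDl ?(ltW h0) //.
    by apply: lerD; apply: ler_wpM2r.
  by rewrite /h mulfVK ?gt_eqF // ltr_pdivrMr // ltr_pMr // ltr1n.
have [y Py ey] := second_difference h0 inP
  (fun y Py => let: And4 a _ _ _ := Py in a).
have inP' s t : 0 <= s <= h -> 0 <= t <= h -> P (s *: v + t *: u + x).
  by move=> sh th; rewrite (addrC (s *: v)); exact: inP.
have [z Pz ez] := second_difference h0 inP'
  (fun y Py => let: And4 _ a _ _ := Py in a).
have yz : 'D_v ('D_u f) y = 'D_u ('D_v f) z.
  apply: (mulIf (lt0r_neq0 h0)); apply: (mulIf (lt0r_neq0 h0)).
  apply: etrans (esym ey) _; apply: etrans _ ez.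
  by rewrite (addrC (h *: v) (h *: u)); congr (_ + _); exact: addrAC.
have [_ _ ly _] := Py; have [_ _ _ lz] := Pz.
rewrite -yz in lz.
exact: tri ly lz.
Qed.

End Schwarz.

(** * Determinants of matrices of functions *)

(** Serves two subalgebras of functions: the smooth ones, and those whose
    derivative at a given point in a given direction is zero. *)
Lemma det_closed (R : comNzRingType) (T : Type) (P : (T -> R) -> Prop) n
    (M : T -> 'M[R]_n) :
  (forall c, P (fun=> c)) ->
  (forall f g, P f -> P g -> P (fun x => f x + g x)) ->
  (forall f g, P f -> P g -> P (fun x => f x * g x)) ->
  (forall i j, P (fun x => M x i j)) ->
  P (fun x => \det (M x)).
Proof.
move=> Pc PD PM PMij.
have Psum (I : Type) (r : seq I) (F : I -> T -> R) :
    (forall i, P (F i)) -> P (fun x => \sum_(i <- r) F i x).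
  move=> PF; elim: r => [|i r ih].
    by under eq_fun do rewrite big_nil; exact: Pc.
  by under eq_fun do rewrite big_cons; apply: PD ih.
have Pprod (I : Type) (r : seq I) (F : I -> T -> R) :
    (forall i, P (F i)) -> P (fun x => \prod_(i <- r) F i x).
  move=> PF; elim: r => [|i r ih].
    by under eq_fun do rewrite big_nil; exact: Pc.
  by under eq_fun do rewrite big_cons; apply: PM ih.
rewrite /determinant; apply: Psum => s.
apply: PM; first exact: Pc.
by apply: Pprod => i; exact: PMij.
Qed.

(** * Smooth functions on an open set *)

Section SmoothCalculus.
Context {R : realType} {n : nat} (W : set 'rV[R]_n) (W_open : open W).
Implicit Types (f g : 'rV[R]_n -> R) (i j : 'I_n) (k : nat).

Lemma near_open x : W x -> \forall y \near x, W y.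
Proof. by move=> Wx; apply: open_nbhs_nbhs; split. Qed.

Lemma eq_on_near f g x : (forall y, W y -> f y = g y) -> W x ->
  \forall y \near x, f y = g y.
Proof.
by move=> fg Wx; apply: (@filterS _ _ (nbhs_filter x)) (near_open Wx) => y /fg.
Qed.

Lemma eq_pderiv f g i x : (forall y, W y -> f y = g y) -> W x ->
  pderiv i f x = pderiv i g x.
Proof. by move=> fg Wx; apply/near_eq_derive/eq_on_near. Qed.

Lemma eq_continuous f g x : (forall y, W y -> f y = g y) -> W x ->
  {for x, continuous f} -> {for x, continuous g}.
Proof.
move=> fg Wx cf; rewrite /prop_for /continuous_at -(fg _ Wx).
apply: cvg_trans cf; apply: (@near_eq_cvg _ _ _ (nbhs_filter x)).
by apply: eq_on_near Wx => y /fg.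
Qed.

(** Regularity on W is a local matter, so a formula for a function need only
    hold on W; this is how the formulas for derivatives below are fed to the
    inductions on k. *)
Lemma eq_class_C k f g : (forall y, W y -> f y = g y) ->
  class_C W k f -> class_C W k g.
Proof.
elim: k f g => [|k ih] f g fg /=.
  by move=> cf x Wx; exact: eq_continuous (cf x Wx).
move=> [cf df]; split=> [x Wx|i]; first exact: eq_continuous (cf x Wx).
have [dfi Cdfi] := df i; split=> [x Wx|].
  by apply: near_eq_derivable (dfi x Wx); exact: eq_on_near.
by apply: ih Cdfi => y Wy; exact: eq_pderiv.
Qed.

Lemma class_C_continuous k f : class_C W k f ->
  forall x, W x -> {for x, continuous f}.
Proof. by case: k => [|k] // []. Qed.

Lemma class_C_pred k f : class_C W k.+1 f -> class_C W k f.
Proof.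
elim: k f => [|k ih] f [cf df] //=; split=> // i.
by have [dfi Cdfi] := df i; split=> //; exact: ih.
Qed.

Lemma class_C_cst k c : class_C W k (fun=> c).
Proof.
elim: k c => [|k ih] c /=; first by move=> x _; exact: cst_continuous.
split=> [x _|i]; first exact: cst_continuous.
split=> [x _|]; first exact: derivable_cst.
by apply: eq_class_C (ih 0) => x _; rewrite /pderiv derive_cst.
Qed.

Lemma class_CD k f g : class_C W k f -> class_C W k g ->
  class_C W k (fun x => f x + g x).
Proof.
elim: k f g => [|k ih] f g.
  by move=> cf cg x Wx; apply: continuousD; [exact: cf|exact: cg].
move=> [cf df] [cg dg]; split=> [x Wx|i].
  by apply: continuousD; [exact: cf|exact: cg].
have [dfi Cdfi] := df i; have [dgi Cdgi] := dg i; split=> [x Wx|].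
  by apply: derivableD; [exact: dfi|exact: dgi].
apply: eq_class_C (ih _ _ Cdfi Cdgi) => x Wx.
by rewrite /pderiv deriveD //; [exact: dfi|exact: dgi].
Qed.

Lemma class_CM k f g : class_C W k f -> class_C W k g ->
  class_C W k (fun x => f x * g x).
Proof.
elim: k f g => [|k ih] f g.
  by move=> cf cg x Wx; apply: continuousM; [exact: cf|exact: cg].
move=> Cf Cg; have [cf df] := Cf; have [cg dg] := Cg; split=> [x Wx|i].
  by apply: continuousM; [exact: cf|exact: cg].
have [dfi Cdfi] := df i; have [dgi Cdgi] := dg i; split=> [x Wx|].
  by apply: derivableM; [exact: dfi|exact: dgi].
apply: eq_class_C
  (class_CD (ih _ _ (class_C_pred Cf) Cdgi) (ih _ _ (class_C_pred Cg) Cdfi)).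
by move=> x Wx; rewrite /pderiv deriveM //; [exact: dfi|exact: dgi].
Qed.

Lemma class_CV k f : (forall x, W x -> f x != 0) -> class_C W k f ->
  class_C W k (fun x => (f x)^-1).
Proof.
move=> f0; elim: k f f0 => [|k ih] f f0.
  by move=> cf x Wx; apply: continuousV; [exact: f0|exact: cf].
move=> Cf; have [cf df] := Cf; split=> [x Wx|i].
  by apply: continuousV; [exact: f0|exact: cf].
have [dfi Cdfi] := df i; split=> [x Wx|].
  by apply: derivableV; [exact: f0|exact: dfi].
have CV := ih _ f0 (class_C_pred Cf).
(* The derivative of 1 / f is - (1 / f) * (1 / f) * d_i f, whose factors the
   induction hypothesis covers. *)
apply: eq_class_C
  (class_CM (class_CM (class_C_cst k (-1)) (class_CM CV CV)) Cdfi).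
move=> x Wx; rewrite /pderiv deriveV ?f0 //; last exact: dfi.
by rewrite expr2 invfM mulN1r.
Qed.

Lemma eq_smooth f g : (forall y, W y -> f y = g y) ->
  smooth_on W f -> smooth_on W g.
Proof. by move=> fg sf k; apply: eq_class_C (sf k). Qed.

Lemma smooth_cst c : smooth_on W (fun=> c).
Proof. by move=> k; exact: class_C_cst. Qed.

Lemma smoothD f g : smooth_on W f -> smooth_on W g ->
  smooth_on W (fun x => f x + g x).
Proof. by move=> sf sg k; exact: class_CD. Qed.

Lemma smoothM f g : smooth_on W f -> smooth_on W g ->
  smooth_on W (fun x => f x * g x).
Proof. by move=> sf sg k; exact: class_CM. Qed.

Lemma smoothV f : (forall x, W x -> f x != 0) -> smooth_on W f ->
  smooth_on W (fun x => (f x)^-1).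
Proof. by move=> f0 sf k; exact: class_CV. Qed.

Lemma smooth_sum (I : Type) (r : seq I) (F : I -> 'rV[R]_n -> R) :
  (forall a, smooth_on W (F a)) -> smooth_on W (fun x => \sum_(a <- r) F a x).
Proof.
move=> sF; elim: r => [|a r ih].
  by under eq_fun do rewrite big_nil; exact: smooth_cst.
by under eq_fun do rewrite big_cons; apply: smoothD.
Qed.

Lemma smooth_derivable f i x : smooth_on W f -> W x ->
  derivable f x (coord_vec i).
Proof. by move=> sf; have [_ df] := sf 1%N; have [+ _] := df i; apply. Qed.

Lemma smooth_pderiv f i : smooth_on W f -> smooth_on W (pderiv i f).
Proof. by move=> sf k; have [_ df] := sf k.+1; have [] := df i. Qed.

Lemma is_derive_coord i j (x : 'rV[R]_n) :
  is_derive x (coord_vec j) (fun y : 'rV[R]_n => y 0 i) (j == i)%:R.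
Proof.
apply: DeriveDef; first exact/diff_derivable/differentiable_coord.
have e : {near 0^', (fun=> (j == i)%:R) =1 (fun h : R => h^-1 *:
    (((fun y : 'rV[R]_n => y 0 i) \o shift x) (h *: coord_vec j) - x 0 i))}.
  near=> h; rewrite /= !mxE addrK eqxx /= eq_sym [_ *: _]mulKf //.
  by near: h; exact: nbhs_dnbhs_neq.
rewrite /derive; apply: cvg_lim => //.
by apply: cvg_trans (near_eq_cvg e) _; exact: cvg_cst.
Unshelve. all: by end_near. Qed.

Lemma smooth_coord i : smooth_on W (fun x => x 0 i).
Proof.
have cc x : {for x, continuous (fun x : 'rV[R]_n => x 0 i)}.
  exact: coord_continuous.
case=> [|k]; first by move=> x _; exact: cc.
split=> [x _|j]; first exact: cc.
split=> [x _|]; first by have [] := is_derive_coord i j x.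
apply: eq_class_C (class_C_cst k (j == i)%:R) => x _.
by have [_ <-] := is_derive_coord i j x.
Qed.

(* Otherwise conversion tests between different partial derivatives unfold the
   limits that define them. *)
#[local] Opaque derive.

Lemma pderivD f g i x : smooth_on W f -> smooth_on W g -> W x ->
  pderiv i (fun y => f y + g y) x = pderiv i f x + pderiv i g x.
Proof. by move=> sf sg Wx; apply: deriveD; exact: smooth_derivable. Qed.

Lemma pderivM f g i x : smooth_on W f -> smooth_on W g -> W x ->
  pderiv i (fun y => f y * g y) x = pderiv i f x * g x + f x * pderiv i g x.
Proof.
move=> sf sg Wx; rewrite /pderiv deriveM; [|exact: smooth_derivable..].
by rewrite addrC; congr (_ + _); exact: mulrC.
Qed.

Lemma pderiv2D f g i x : smooth_on W f -> smooth_on W g -> W x ->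
  pderiv i (pderiv i (fun y => f y + g y)) x =
  pderiv i (pderiv i f) x + pderiv i (pderiv i g) x.
Proof.
move=> sf sg Wx.
rewrite -(@pderivD (pderiv i f) (pderiv i g)) //; try exact: smooth_pderiv.
by apply: eq_pderiv => // y Wy; exact: pderivD.
Qed.

Lemma pderiv2M f g i x : smooth_on W f -> smooth_on W g -> W x ->
  pderiv i (pderiv i (fun y => f y * g y)) x =
  pderiv i (pderiv i f) x * g x + 2 * pderiv i f x * pderiv i g x
  + f x * pderiv i (pderiv i g) x.
Proof.
move=> sf sg Wx; have sf' := smooth_pderiv i sf; have sg' := smooth_pderiv i sg.
rewrite (@eq_pderiv _ (fun y => pderiv i f y * g y + f y * pderiv i g y)) //.
  rewrite (@pderivD (fun y => pderiv i f y * g y)) //; try exact: smoothM.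
  rewrite (pderivM i sf' sg Wx) (pderivM i sf sg' Wx).
  by rewrite -mulrA mulr_natl mulr2n !addrA.
by move=> y Wy; exact: pderivM.
Qed.

Lemma pderiv_comm f i j x : smooth_on W f -> W x ->
  pderiv i (pderiv j f) x = pderiv j (pderiv i f) x.
Proof.
move=> sf Wx; apply: derive_comm; last 2 first.
- exact: class_C_continuous (smooth_pderiv _ (smooth_pderiv _ sf) 0) _ _.
- exact: class_C_continuous (smooth_pderiv _ (smooth_pderiv _ sf) 0) _ _.
- apply: (@filterS _ _ (nbhs_filter x)) (near_open Wx) => y Wy.
  by split; apply: smooth_derivable => //; exact: smooth_pderiv.
- apply: (@filterS _ _ (nbhs_filter x)) (near_open Wx) => y Wy.
  by split; apply: smooth_derivable => //; exact: smooth_pderiv.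
Qed.

Lemma pderiv_sum (I : Type) (r : seq I) (F : I -> 'rV[R]_n -> R) i x :
  (forall a, smooth_on W (F a)) -> W x ->
  pderiv i (fun y => \sum_(a <- r) F a y) x = \sum_(a <- r) pderiv i (F a) x.
Proof.
move=> sF Wx; elim: r => [|a r ih].
  by rewrite big_nil; under eq_fun do rewrite big_nil; exact: derive_cst.
rewrite big_cons -ih; under eq_fun do rewrite big_cons.
by apply: pderivD => //; exact: smooth_sum.
Qed.

(** * Schrodinger operators in one variable *)

Definition schrodinger i (V f : 'rV[R]_n -> R) : 'rV[R]_n -> R :=
  fun x => pderiv i (pderiv i f) x + V x * f x.

Lemma eq_schrodinger i V f g x : (forall y, W y -> f y = g y) -> W x ->
  schrodinger i V f x = schrodinger i V g x.
Proof.
move=> fg Wx; rewrite /schrodinger.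
have e2 : pderiv i (pderiv i f) x = pderiv i (pderiv i g) x.
  apply: (@eq_pderiv (pderiv i f) (pderiv i g) _ _ _ Wx) => y.
  exact: (eq_pderiv _ fg).
by rewrite e2 (fg _ Wx).
Qed.

Lemma schrodinger_sum (I : Type) (r : seq I) i V (F : I -> 'rV[R]_n -> R) x :
  (forall a, smooth_on W (F a)) -> W x ->
  schrodinger i V (fun y => \sum_(a <- r) F a y) x =
  \sum_(a <- r) schrodinger i V (F a) x.
Proof.
move=> sF Wx; rewrite /schrodinger big_split /= mulr_sumr; congr (_ + _).
rewrite -(@pderiv_sum _ _ (fun a => pderiv i (F a))) //; last first.
  by move=> a; exact: smooth_pderiv.
by apply: eq_pderiv => // y Wy; exact: pderiv_sum.
Qed.

(** A factor that does not depend on x^i is a scalar for an operator that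
    differentiates in x^i alone. *)
Lemma schrodingerM i V c g x : smooth_on W c -> smooth_on W g ->
  (forall y, W y -> pderiv i c y = 0) -> W x ->
  schrodinger i V (fun y => c y * g y) x = c x * schrodinger i V g x.
Proof.
move=> sc sg c0 Wx; rewrite /schrodinger (pderiv2M i sc sg Wx) (c0 _ Wx).
have -> : pderiv i (pderiv i c) x = 0.
  by rewrite (@eq_pderiv _ (fun=> 0)) // /pderiv derive_cst.
by ring.
Qed.

(** Everything symmetric in the two operators cancels: the fourth order term
    d_i^2 d_j^2 f, the products V1 * V2 * f, and the terms V2 * d_i^2 f and
    V1 * d_j^2 f. What remains measures how V2 varies with x^i and V1 with
    x^j. *)
Lemma schrodinger_comm i j V1 V2 f x :
  smooth_on W V1 -> smooth_on W V2 -> smooth_on W f -> W x ->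
  schrodinger i V1 (schrodinger j V2 f) x -
    schrodinger j V2 (schrodinger i V1 f) x =
  (pderiv i (pderiv i V2) x * f x + 2 * pderiv i V2 x * pderiv i f x) -
  (pderiv j (pderiv j V1) x * f x + 2 * pderiv j V1 x * pderiv j f x).
Proof.
move=> sV1 sV2 sf Wx.
have sd (a b : 'I_n) : smooth_on W (pderiv a (pderiv b f)).
  exact/smooth_pderiv/smooth_pderiv.
have ex : pderiv i (pderiv i (pderiv j (pderiv j f))) x =
          pderiv j (pderiv j (pderiv i (pderiv i f))) x.
  have sd1 a := smooth_pderiv a sf.
  have e1 y : W y -> pderiv i (pderiv j (pderiv j f)) y =
                     pderiv j (pderiv j (pderiv i f)) y.
    move=> Wy; apply: etrans (pderiv_comm i j (sd1 j) Wy) _.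
    by apply: (eq_pderiv j _ Wy) => z Wz; exact: pderiv_comm.
  apply: etrans (eq_pderiv i e1 Wx) _.
  apply: etrans (pderiv_comm i j (sd j i) Wx) _.
  by apply: (eq_pderiv j _ Wx) => y Wy; exact: pderiv_comm.
rewrite /schrodinger.
rewrite (pderiv2D i (sd j j) (smoothM sV2 sf) Wx) (pderiv2M i sV2 sf Wx).
rewrite (pderiv2D j (sd i i) (smoothM sV1 sf) Wx) (pderiv2M j sV1 sf Wx).
have alg (d d' v1 v2 v1' v2' v1'' v2'' f0 fi fj fii fjj : R) : d = d' ->
    d + (v2'' * f0 + 2 * v2' * fi + v2 * fii) + v1 * (fjj + v2 * f0) -
    (d' + (v1'' * f0 + 2 * v1' * fj + v1 * fjj) + v2 * (fii + v1 * f0)) =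
    (v2'' * f0 + 2 * v2' * fi) - (v1'' * f0 + 2 * v1' * fj).
  by move=> ->; ring.
exact: alg ex.
Qed.

End SmoothCalculus.

(** * Stackel operators *)

Lemma mulmx_solve (K : comUnitRingType) m (A : 'M[K]_m) (d : 'I_m -> K) i :
  A \in unitmx -> \sum_a A i a * (\sum_k invmx A a k * d k) = d i.
Proof.
move=> uA; have /colP/(_ i) := mulKVmx uA (\col_k d k); rewrite !mxE => <-.
apply: eq_bigr => a _; rewrite mxE; congr (_ * _).
by apply: eq_bigr => k _; rewrite !mxE.
Qed.

Section Stackel.
Context {R : realType} {n : nat} (W : set 'rV[R]_n) (W_open : open W)
  (S : 'rV[R]_n -> 'M[R]_n)
  (S_smooth : forall i j : 'I_n, smooth_on W (fun x => S x i j))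
  (S_nondeg : forall x, W x -> S x \in unitmx)
  (S_rows : forall i j : 'I_n, depends_only_on W i (fun x => S x i j)).

(** The cofactor of (i, a) is a polynomial in the rows of S other than the i-th
    one, and these do not depend on x^i. *)
Lemma is_derive_cofactor a i x : W x ->
  is_derive x (coord_vec i) (fun y => cofactor (S y) i a) 0.
Proof.
move=> Wx.
have PM (f g : 'rV[R]_n -> R) : is_derive x (coord_vec i) f 0 ->
    is_derive x (coord_vec i) g 0 ->
    is_derive x (coord_vec i) (fun y => f y * g y) 0.
  move=> df dg; apply: is_derive_eq (is_deriveM df dg) _.
  by rewrite !scaler0 addr0.
rewrite /cofactor; apply: (PM _ _ (is_derive_cst _ _ _)).
apply: (@det_closed R _ (fun f => is_derive x (coord_vec i) f 0) _
  (fun y => row' i (col' a (S y)))) => //.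
- by move=> c; exact: is_derive_cst.
- by move=> f g df dg; apply: is_derive_eq (is_deriveD df dg) _; rewrite addr0.
move=> k l; under eq_fun do rewrite !mxE.
exact: S_rows (neq_lift i k).
Qed.

Lemma smooth_det m (M : 'rV[R]_n -> 'M[R]_m) :
  (forall k l, smooth_on W (fun x => M x k l)) ->
  smooth_on W (fun x => \det (M x)).
Proof.
move=> sM; apply: (@det_closed R _ (smooth_on W)) => //.
- by move=> c; exact: smooth_cst.
- by move=> f g; exact: smoothD.
- by move=> f g; exact: smoothM.
Qed.

Lemma det_neq0 x : W x -> \det (S x) != 0.
Proof. by move=> /S_nondeg; rewrite unitmxE unitfE. Qed.

Lemma invmxE x a i : W x ->
  invmx (S x) a i = (\det (S x))^-1 * cofactor (S x) i a.
Proof. by move=> Wx; rewrite /invmx S_nondeg // !mxE. Qed.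

Lemma smooth_cofactor a i : smooth_on W (fun x => cofactor (S x) i a).
Proof.
rewrite /cofactor; apply: (smoothM W_open (smooth_cst W_open _)).
apply: smooth_det => k l; under eq_fun do rewrite !mxE.
exact: S_smooth.
Qed.

Lemma smooth_invmx a i : smooth_on W (fun x => invmx (S x) a i).
Proof.
apply: (@eq_smooth _ _ _ W_open (fun x => (\det (S x))^-1 * cofactor (S x) i a)).
  by move=> x Wx; rewrite invmxE.
apply: smoothM => //; last exact: smooth_cofactor.
by apply: smoothV => //; [exact: det_neq0 | exact: smooth_det].
Qed.

(** In the flux det S * A_(a i) * d_i f the coefficient is a cofactor free of
    x^i, so the outer derivative only hits d_i f and the weight det S cancels. *)
Lemma HhatE a f x : smooth_on W f -> W x ->
  Hhat S a f x = \sum_i invmx (S x) a i * pderiv i (pderiv i f) x.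
Proof.
move=> sf Wx; apply: eq_bigr => i _; rewrite (bigD1 i) //= big1 ?addr0.
  rewrite /stackel_tensor eqxx.
  rewrite (@eq_pderiv _ _ _ W_open _
    (fun y => cofactor (S y) i a * pderiv i f y)) //.
    rewrite (pderivM i (smooth_cofactor a i) (smooth_pderiv i sf) Wx).
    have [_ e] := is_derive_cofactor a i Wx.
    by rewrite {1}/pderiv e mul0r add0r mulrA invmxE.
  move=> y Wy; rewrite invmxE //; congr (_ * _).
  by rewrite mulrAC mulVf ?mul1r // det_neq0.
move=> j ji; rewrite /stackel_tensor eq_sym (negbTE ji).
under eq_fun do rewrite !mul0r.
by rewrite /pderiv derive_cst mulr0.
Qed.

Context (U V : 'I_n -> 'rV[R]_n -> R)
  (U_smooth : forall i, smooth_on W (U i))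
  (UV : forall x, W x -> S x *m \col_i U i x = \col_i V i x).

Lemma smooth_Hcheck a f : smooth_on W f -> smooth_on W (Hcheck S U a f).
Proof.
move=> sf; apply: (@eq_smooth _ _ _ W_open (fun x =>
    \sum_i invmx (S x) a i * pderiv i (pderiv i f) x + U a x * f x)).
  by move=> x Wx; rewrite /Hcheck HhatE.
apply: smoothD => //; last exact: smoothM.
apply: smooth_sum => // i; apply: smoothM => //; first exact: smooth_invmx.
exact/smooth_pderiv/smooth_pderiv.
Qed.

(** Separation of variables: S inverts the passage from the second derivatives
    d_i^2 to the operators Hhat_a, and turns the potentials U into V. *)
Lemma stackel_separation i f x : smooth_on W f -> W x ->
  schrodinger i (V i) f x = \sum_a S x i a * Hcheck S U a f x.
Proof.
move=> sf Wx; rewrite /Hcheck /schrodinger.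
have <- : \sum_a S x i a * U a x = V i x.
  have /colP/(_ i) := UV Wx; rewrite !mxE => <-.
  by apply: eq_bigr => a _; rewrite mxE.
under [RHS]eq_bigr do rewrite (HhatE _ sf Wx) mulrDr mulrA.
rewrite big_split /= -mulr_suml; congr (_ + _).
by rewrite (mulmx_solve (fun k => pderiv k (pderiv k f) x) i (S_nondeg Wx)).
Qed.

Lemma schrodinger_comp i j f x : i != j -> smooth_on W f -> W x ->
  schrodinger i (V i) (schrodinger j (V j) f) x =
  \sum_b \sum_a S x j b * S x i a * Hcheck S U a (Hcheck S U b f) x.
Proof.
move=> ij sf Wx; have sH b := smooth_Hcheck b sf.
rewrite (eq_schrodinger W_open _ _ (fun y => @stackel_separation j f y sf) Wx).
rewrite (@schrodinger_sum _ _ _ W_open _ _ i (V i)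
  (fun b y => S y j b * Hcheck S U b f y)) //; last first.
  by move=> b; exact: smoothM.
apply: eq_bigr => b _.
rewrite (@schrodingerM _ _ _ W_open i _ (fun y => S y j b)) //; last first.
  by move=> y Wy; have [_] := S_rows b Wy ij.
rewrite stackel_separation // mulr_sumr.
by apply: eq_bigr => a _; rewrite mulrA.
Qed.

Definition Hcomm f x : 'M[R]_n := \matrix_(a, b)
  (Hcheck S U a (Hcheck S U b f) x - Hcheck S U b (Hcheck S U a f) x).

(** The commutators of the one-dimensional operators are the off-diagonal
    entries of a congruence transform of the matrix of commutators of the
    Stackel operators, which lets vanishing be transported both ways. *)
Lemma schrodinger_Hcomm i j f x : i != j -> smooth_on W f -> W x ->
  schrodinger i (V i) (schrodinger j (V j) f) x -
  schrodinger j (V j) (schrodinger i (V i) f) x =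
  (S x *m Hcomm f x *m (S x)^T) i j.
Proof.
move=> ij sf Wx; rewrite !schrodinger_comp //; last by rewrite eq_sym.
rewrite [X in _ - X]exchange_big -sumrB mxE; apply: eq_bigr => b _.
rewrite -sumrB !mxE mulr_suml; apply: eq_bigr => a _.
by rewrite !mxE; ring.
Qed.

End Stackel.

(** * The two implications *)

Lemma stackel_commute (R : realType) (n : nat) (W : set 'rV[R]_n)
    (S : 'rV[R]_n -> 'M[R]_n) (U V : 'I_n -> 'rV[R]_n -> R) :
  open W -> (forall i j : 'I_n, smooth_on W (fun x => S x i j)) ->
  (forall x, W x -> S x \in unitmx) ->
  (forall i j : 'I_n, depends_only_on W i (fun x => S x i j)) ->
  (forall i, smooth_on W (V i)) -> (forall i, depends_only_on W i (V i)) ->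
  (forall x, W x -> S x *m \col_i U i x = \col_i V i x) ->
  forall i j : 'I_n, commute_on W (Hcheck S U i) (Hcheck S U j).
Proof.
move=> Wo Ss Sn Sr sV Vi UV.
have sU a : smooth_on W (U a).
  apply: (@eq_smooth _ _ _ Wo (fun x => \sum_i invmx (S x) a i * V i x)).
    move=> x Wx; have /colP/(_ a) := mulKmx (Sn _ Wx) (\col_i U i x).
    rewrite UV // !mxE => <-.
    by apply: eq_bigr => i _; rewrite mxE.
  by apply: smooth_sum => // i; apply: smoothM => //; exact: smooth_invmx.
move=> a b f sf x Wx.
have V0 i j : i != j -> forall y, W y -> pderiv i (V j) y = 0.
  by move=> ij y Wy; have [_] := Vi j y i Wy ij.
have V00 i j : i != j -> pderiv i (pderiv i (V j)) x = 0.
  move=> ij; rewrite (@eq_pderiv _ _ _ Wo _ (fun=> 0)) //; last exact: V0.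
  by rewrite /pderiv derive_cst.
(* The diagonal of S C S^T is zero because C is antisymmetric; the other
   entries are commutators of the operators d_i^2 + V_i. *)
pose C := Hcomm S U f x.
have CT : C^T = - C by apply/matrixP => i j; rewrite !mxE opprB.
have : S x *m C *m (S x)^T = 0.
  apply/matrixP => i j; rewrite [RHS]mxE; have [<-|ij] := eqVneq i j.
    have /matrixP/(_ i i) : (S x *m C *m (S x)^T)^T = - (S x *m C *m (S x)^T).
      by rewrite !trmx_mul trmxK CT mulNmx mulmxN mulmxA.
    by rewrite !mxE => e; lra.
  rewrite -(@schrodinger_Hcomm _ _ _ Wo _ Ss Sn Sr U V) //.
  by rewrite (schrodinger_comm Wo) // !V00 // ?V0 // 1?eq_sym //; ring.
move=> /(congr1 (mulmx (invmx (S x)))) /(congr1 (mulmx^~ (invmx (S x)^T))).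
rewrite mulmx0 mul0mx -!mulmxA mulmxV ?unitmx_tr ?Sn // mulmx1 mulKmx ?Sn //.
by move=> /matrixP/(_ a b); rewrite !mxE => /eqP; rewrite subr_eq0 => /eqP.
Qed.

Lemma commute_stackel (R : realType) (n : nat) (W : set 'rV[R]_n)
    (S : 'rV[R]_n -> 'M[R]_n) (U : 'I_n -> 'rV[R]_n -> R) :
  open W -> (forall i j : 'I_n, smooth_on W (fun x => S x i j)) ->
  (forall x, W x -> S x \in unitmx) ->
  (forall i j : 'I_n, depends_only_on W i (fun x => S x i j)) ->
  (forall i, smooth_on W (U i)) ->
  (forall i j : 'I_n, commute_on W (Hcheck S U i) (Hcheck S U j)) ->
  forall i, depends_only_on W i (fun x => \sum_a S x i a * U a x).
Proof.
move=> Wo Ss Sn Sr sU cU j x i Wx ij.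
pose V k x := \sum_a S x k a * U a x.
have sV k : smooth_on W (V k).
  by apply: smooth_sum => // a; exact: smoothM.
have UV y : W y -> S y *m \col_i U i y = \col_i V i y.
  move=> _; apply/colP => k; rewrite !mxE.
  by apply: eq_bigr => a _; rewrite mxE.
have comm f : smooth_on W f ->
    pderiv i (pderiv i (V j)) x * f x + 2 * pderiv i (V j) x * pderiv i f x =
    pderiv j (pderiv j (V i)) x * f x + 2 * pderiv j (V i) x * pderiv j f x.
  move=> sf; apply/eqP; rewrite -subr_eq0 -(schrodinger_comm Wo) //.
  rewrite (@schrodinger_Hcomm _ _ _ Wo _ Ss Sn Sr U V) //.
  have -> : Hcomm S U f x = 0.
    by apply/matrixP => a b; rewrite !mxE cU ?subrr.
  by rewrite mulmx0 mul0mx mxE.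
(* The case f = 1 identifies the zeroth order terms; they then cancel in the
   case f = x^i, which leaves 2 d_i V_j = 0. *)
have alg (a b c d t : R) : a * 1 + 2 * c * 0 = b * 1 + 2 * d * 0 ->
    a * t + 2 * c * 1 = b * t + 2 * d * 0 -> c = 0.
  by rewrite !mulr0 !addr0 !mulr1 => ->; lra.
have c1 := comm _ (smooth_cst Wo 1).
have cx := comm _ (smooth_coord Wo i).
have p1 k : pderiv k (fun=> 1) x = 0 :> R by exact: derive_cst.
have px k : pderiv k (fun y => y 0 i) x = (k == i)%:R :> R.
  by have [_] := is_derive_coord i k x.
rewrite !p1 in c1; rewrite !px eqxx eq_sym (negbTE ij) in cx.
have V0 : pderiv i (V j) x = 0 by exact: alg c1 cx.
exact: is_derive_eq (derivableP (smooth_derivable (sV j) Wx)) V0.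
Qed.

Theorem theorem4 (R : realType) (n : nat) (W : set 'rV[R]_n)
    (S : 'rV[R]_n -> 'M[R]_n)
    (W_open : open W) (W_sc : simply_connected W)
    (S_smooth : forall i j : 'I_n, smooth_on W (fun x => S x i j))
    (S_nondeg : forall x, W x -> S x \in unitmx)
    (S_rows : forall i j : 'I_n, depends_only_on W i (fun x => S x i j)) :
  (forall V U : 'I_n -> 'rV[R]_n -> R,
     (forall i, smooth_on W (V i)) ->
     (forall i, depends_only_on W i (V i)) ->
     (forall x, W x -> S x *m \col_i U i x = \col_i V i x) ->
     forall i j : 'I_n, commute_on W (Hcheck S U i) (Hcheck S U j)) /\
  (forall U : 'I_n -> 'rV[R]_n -> R,
     (forall i, smooth_on W (U i)) ->
     (forall i j : 'I_n, commute_on W (Hcheck S U i) (Hcheck S U j)) ->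
     exists V : 'I_n -> 'rV[R]_n -> R,
       (forall i, depends_only_on W i (V i)) /\
       (forall x, W x -> S x *m \col_i U i x = \col_i V i x)).
Proof.
split=> [V U sV Vi UV|U sU cU]; first exact: stackel_commute UV.
exists (fun i x => \sum_a S x i a * U a x); split; first exact: commute_stackel.
move=> x _; apply/colP => k; rewrite !mxE.
by apply: eq_bigr => a _; rewrite mxE.
Qed.
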